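(* Consider the three-term recurrence relation $$c_ny_{n+1}+c_{n-1}y_{n-1}-b_ny_n=0,\qquad n\ge 1,$$ where $b_n\in\mathbb{R}$, and $c_n>0$ for every $n\ge n_0$ for some $n_0\ge 1$, and $\sum_{n=1}^{\infty}c_{n-1}^{-k}<\infty$ for some $k\ge 1$. Suppose further that $b_n-c_n-c_{n-1}>\varepsilon_nc_n$ for all sufficiently large $n$, for some sequence $\varepsilon_n>0$ with $\sum_{n=1}^\infty\varepsilon_n=\infty$. Put $k'=k/(k-1)$ if $k>1$ and $k'=\infty$ (with $\delta/k'=0$) if $k=1$. Let $0\le A_0<A_1$ be given and let $(A_m)$ be the resulting solution, and suppose $A_m\in\mathbb{Q}^+$ for all large $m$ and $\sum_{n=1}^\infty A_n^{-\delta}<\infty$ for some $\delta$ with $0<\delta<k'$. Let $(B_m)$ be a solution linearly independent of $(A_m)$ with $B_m\in\mathbb{Q}$ for all sufficiently large $m$, and suppose there are sequences $d_m,e_m\in\mathbb{Z}^+$ with $d_mA_m\in\mathbb{Z}^+$ and $e_mB_m\in\mathbb{Z}^+$ for all sufficiently large $m$, and $$\lim_{m\to\infty}\frac{\operatorname{lcm}\{d_m,e_m\}}{A_m^{\,1-\delta/k'}}=0.$$ Then $L=\lim_{m\to\infty}B_m/A_m$ is an irrational number. *)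

(* Defs.v *)
From HB Require Import structures.
From mathcomp Require Import all_boot all_order all_algebra.
From mathcomp Require Import all_classical all_reals all_analysis.

Set Implicit Arguments.
Unset Strict Implicit.
Unset Printing Implicit Defensive.

Import Order.TTheory GRing.Theory Num.Theory.
Import numFieldNormedType.Exports.

Local Open Scope classical_set_scope.
Local Open Scope ring_scope.

Section Recurrence.
Variable R : realType.
Implicit Types (b c y : nat -> R) (k delta : R).

(* The value [b 0] is never used. *)
Definition is_solution b c y : Prop :=
  forall n : nat, (1 <= n)%N ->
    c n * y n.+1 + c n.-1 * y n.-1 - b n * y n = 0.

(* Linear independence of two sequences in the space [nat -> R]; [free] is not
   available because that space is not finite dimensional. *)
Definition lin_indep y1 y2 : Prop :=
  forall s t : R, (forall n : nat, s * y1 n + t * y2 n = 0) -> s = 0 /\ t = 0.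

(* sum_(n >= 1) (u n)^(-p) < +oo. Since [powR] takes finite values >= 0
   everywhere, finitely many terms u n <= 0 (for which a real power is not
   meaningful) do not influence this condition; in particular u n = 0 is not
   excluded, so that nonvanishing has to be required separately. *)
Definition negpow_summable (u : nat -> R) (p : R) : Prop :=
  (\sum_(1 <= n <oo) (u n `^ (- p))%:E < +oo)%E.

(* delta / k' with k' = k / (k - 1) the conjugate exponent; the conventions
   1' = +oo and delta / +oo = 0 are those of [hoelder_conjugate] and of the
   inverse on extended reals. *)
Definition div_conj delta k : R :=
  fine (delta%:E / hoelder_conjugate k%:E)%E.

End Recurrence.

(* Main.v *)
Require Import Defs.
From HB Require Import structures.
From mathcomp Require Import all_boot all_order all_algebra.
From mathcomp Require Import all_classical all_reals all_analysis.
From mathcomp Require Import ring lra.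

Import Order.TTheory GRing.Theory Num.Theory.
Import numFieldNormedType.Exports.

Local Open Scope classical_set_scope.
Local Open Scope ring_scope.

(** The Casoratian identity gives
      [B n.+1 / A n.+1 - B n / A n = w / (c n * A n * A n.+1)]
    with a constant [w != 0], so the ratios are eventually strictly monotone.
    Since A eventually increases and [th = delta / k' < 2],
      [1 / (c n * A n * A n.+1) <= A m `^ (th - 2) * (1 / c n * A n `^ (- th))]
    for n >= m, and Young's inequality bounds the sum of the last factors by the
    two convergent series.  Hence [0 < `|A m * L - B m| <= C * A m `^ (th - 1)].
    Multiplying by [lcmn (d m) (e m)] turns A m and B m into integers while the
    product still tends to 0, which is impossible for a rational L. *)

(** * Casoratian of two solutions *)

Lemma solution_eq0 {R : realType} (b c y : nat -> R) :
  (forall n, c n != 0) -> is_solution b c y -> y 0%N = 0 -> y 1%N = 0 ->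
  forall n, y n = 0.
Proof.
move=> c_neq0 ysol y0 y1 n.
suff [] : y n = 0 /\ y n.+1 = 0 by [].
elim: n => [//|n [yn ySn]]; split=> //.
have := ysol n.+1 isT; rewrite /= yn ySn !mulr0 addr0 subr0 => /eqP.
by rewrite mulf_eq0 (negPf (c_neq0 _)) /= => /eqP.
Qed.

Definition casoratian {R : realType} (y z : nat -> R) (n : nat) : R :=
  y n * z n.+1 - y n.+1 * z n.

(** Multiplying the recurrence of [z] by [y n.+1], that of [y] by [z n.+1], and subtracting cancels
    the [b] terms and leaves [c n.+1 * casoratian y z n.+1 = c n * casoratian y z n]. *)
Lemma casoratian_const {R : realType} (b c y z : nat -> R) :
  is_solution b c y -> is_solution b c z ->
  forall n, c n * casoratian y z n = c 0%N * casoratian y z 0.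
Proof.
move=> ysol zsol; elim=> [//|n <-]; rewrite /casoratian.
have := ysol n.+1 isT; have := zsol n.+1 isT; rewrite /= => hz hy.
apply/eqP; rewrite -subr_eq0; apply/eqP.
transitivity (y n.+1 * (c n.+1 * z n.+2 + c n * z n - b n.+1 * z n.+1)
  - z n.+1 * (c n.+1 * y n.+2 + c n * y n - b n.+1 * y n.+1)); first by ring.
by rewrite hz hy !mulr0 subr0.
Qed.

(** If it vanished, [z 1 * y - y 1 * z] would be a solution with value 0 at both 0 and 1, hence
    identically zero: a linear dependence with the nonzero coefficient [- y 1]. *)
Lemma casoratian_neq0 {R : realType} (b c y z : nat -> R) :
  (forall n, c n != 0) -> is_solution b c y -> is_solution b c z ->
  y 1%N != 0 -> lin_indep y z -> casoratian y z 0 != 0.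
Proof.
move=> c_neq0 ysol zsol y1 indep; apply/eqP; rewrite /casoratian => W0.
have [|_ /eqP] := indep (z 1%N) (- y 1%N); last by rewrite oppr_eq0 (negPf y1).
apply: (@solution_eq0 _ b c (fun n => z 1%N * y n + - y 1%N * z n)) => //.
- move=> n n1 /=.
  transitivity (z 1%N * (c n * y n.+1 + c n.-1 * y n.-1 - b n * y n)
    - y 1%N * (c n * z n.+1 + c n.-1 * z n.-1 - b n * z n)); first by ring.
  by rewrite ysol // zsol // !mulr0 subr0.
- by rewrite -W0; ring.
- by ring.
Qed.

(** * Summability and conjugate exponents *)

Lemma negpow_summable_bounded {R : realType} (u : nat -> R) (p : R) :
  negpow_summable u p -> exists S : R, forall m n, (1 <= m)%N ->
    \sum_(m <= i < n) u i `^ (- p) <= S.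
Proof.
rewrite /negpow_summable => h.
have uge0 i : (1 <= i)%N -> xpredT i -> (0 <= (u i `^ (- p))%:E :> \bar R)%E.
  by move=> _ _; rewrite lee_fin powR_ge0.
exists (fine (\sum_(1 <= i <oo) (u i `^ (- p))%:E)%E) => m n m1.
rewrite -lee_fin fineK; last first.
  by rewrite ge0_fin_numE //; exact: nneseries_ge0.
apply: (le_trans _ (nneseries_lim_ge n uge0)).
rewrite sumEFin lee_fin.
case: (leqP m n) => [mn|/ltnW nm]; last first.
  by rewrite big_geq //; apply: sumr_ge0 => i _; exact: powR_ge0.
rewrite (big_cat_nat m1 mn) /= lerDr.
by apply: sumr_ge0 => i _; exact: powR_ge0.
Qed.

(** A purely real formula that also covers [k = 1], where the conjugate exponent is infinite and
    both sides are 0. *)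
Lemma div_conjE {R : realType} (delta k : R) :
  1 <= k -> div_conj delta k = delta * (1 - k^-1).
Proof.
move=> k1; have k0 : 0 < k by lra.
rewrite /div_conj /hoelder_conjugate /= eqe gt_eqF //.
have [->|kn1] := eqVneq k 1.
  by rewrite subee // inve0 mul1e invey mule0 invr1 subrr mulr0.
have km1 : k - 1 != 0 by rewrite subr_eq0.
rewrite -EFinD inver (negPf km1) -EFinM inver mulf_eq0 invr_eq0 (negPf km1).
rewrite gt_eqF //= -?EFinM /=; field.
by rewrite km1 gt_eqF.
Qed.

Lemma div_conj_lt1 {R : realType} (delta k : R) :
  1 <= k -> (delta%:E < hoelder_conjugate k%:E)%E -> div_conj delta k < 1.
Proof.
move=> k1; have k0 : 0 < k by lra.
rewrite div_conjE //; have [->|kn1] := eqVneq k 1.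
  by rewrite invr1 subrr mulr0.
have km1 : k - 1 != 0 by rewrite subr_eq0.
have km1' : 0 < k - 1 by rewrite lt_def km1 subr_ge0.
rewrite /hoelder_conjugate /= eqe gt_eqF //.
rewrite -EFinD inver (negPf km1) -EFinM lte_fin ltr_pdivlMr // => h.
have -> : delta * (1 - k^-1) = delta * (k - 1) / k by field; rewrite gt_eqF.
by rewrite ltr_pdivrMr // mul1r.
Qed.

(** Young's inequality with exponents [k] and [k / (k - 1)]: raising the power of [y] to the
    conjugate exponent gives exactly the exponent [- delta]. For [k = 1] that power is 1 and the
    left side is already the first summand. *)
Lemma young_div_conj {R : realType} (delta k x y : R) :
  1 <= k -> 0 < x -> 0 < y ->
  x^-1 * y `^ (- div_conj delta k) <= x `^ (- k) + y `^ (- delta).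
Proof.
move=> k1 x0 y0; have k0 : 0 < k by lra.
rewrite div_conjE //; have [->|kn1] := eqVneq k 1.
  by rewrite invr1 subrr mulr0 oppr0 powRr0 mulr1 powR_inv1 ?(ltW x0) // lerDl powR_ge0.
have km1 : 0 < k - 1 by rewrite lt_def subr_eq0 kn1 subr_ge0.
have xV : 0 <= x^-1 by rewrite invr_ge0 ltW.
have conj : k^-1 + (k / (k - 1))^-1 = 1.
  by field; rewrite !gt_eqF.
have k'0 : 0 < k / (k - 1) by rewrite divr_gt0.
apply: (le_trans (conjugate_powR xV (powR_ge0 _ _) k0 k'0 conj)).
rewrite -powRrM -(powR_inv1 (ltW x0)) -powRrM mulN1r.
have -> : - (delta * (1 - k^-1)) * (k / (k - 1)) = - delta.
  by field; rewrite !gt_eqF.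
have kV : k^-1 <= 1 by rewrite invf_le1.
have k'V : (k / (k - 1))^-1 <= 1.
  by rewrite -[leRHS]conj lerDr invr_ge0 ltW.
by apply: lerD; rewrite ler_piMr ?powR_ge0.
Qed.

(** * Irrationality criterion *)

Lemma irrational_approx {R : realType} (L : R) (u v : nat -> R) :
  (\forall m \near \oo, [/\ u m \is a Num.int, v m \is a Num.int
                          & u m * L - v m != 0]) ->
  u m * L - v m @[m --> \oo] --> (0 : R) -> irrational L.
Proof.
move=> huv hlim [x _ xL].
have q0 : (0 : R) < (denq x)%:~R by rewrite ltr0z denq_gt0.
have LE : L * (denq x)%:~R = (numq x)%:~R by rewrite -xL /ratr divfK ?gt_eqF.
have [N _ hN] : \forall m \near \oo, `|u m * L - v m| < (denq x)%:~R^-1.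
  by move/cvgr0Pnorm_lt: hlim; apply; rewrite invr_gt0.
have [N' _ hN'] := huv.
pose N0 := maxn N N'.
have := hN N0 (leq_maxl N N'); have [ui vi uvn] := hN' N0 (leq_maxr N N').
(* Multiplication by the denominator of [L] turns [u N0 * L - v N0] into a nonzero integer, of
   absolute value at least 1, against the smallness just obtained. *)
rewrite -[X in _ < X]mul1r ltr_pdivlMr // ltNge => /negP; apply.
rewrite -[X in _ * X](gtr0_norm q0) -normrM norm_intr_ge1 //; last first.
  by rewrite mulf_neq0 // gt_eqF.
rewrite mulrBl -mulrA LE.
by apply: rpredB; apply: rpredM; rewrite ?intr_int.
Qed.

(** * Eventual growth of the solution [A] *)

Lemma solution_nondecreasing {R : realType} (b c A : nat -> R) (delta : R) :
  is_solution b c A ->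
  (\forall n \near \oo, 0 < A n /\ 0 < c n) ->
  (\forall n \near \oo, c n + c n.-1 < b n) ->
  0 < delta -> negpow_summable A delta -> {near \oo, nondecreasing_seq A}.
Proof.
move=> Asol [N1 _ h1] [N2 _ h2] delta0 /negpow_summable_bounded [S hS].
(* The successor ensures [1 <= N], so that [hS] applies to blocks starting at [N]. *)
pose N := (maxn N1 N2).+1.
have pos n : (N <= n.+1)%N -> 0 < A n /\ 0 < c n.
  by move=> Nn; apply: h1; rewrite /= (leq_trans (leq_maxl _ _) Nn).
have bn n : (N <= n.+1)%N -> c n + c n.-1 < b n.
  by move=> Nn; apply: h2; rewrite /= (leq_trans (leq_maxr _ _) Nn).
(* If [A] never rose from [N] on, it would stay below [A N]; the terms of the summable series would
   be bounded below by a positive constant. *)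
have [n0 Nn0 An0] : exists2 n, (N <= n)%N & A n < A n.+1.
  apply: contrapT => /forall2NP noinc.
  have Ale n : (N <= n)%N -> A n <= A N.
    move=> /subnK <-; elim: (n - N)%N => [//|j IH]; apply: le_trans IH.
    by case: (noinc (j + N)%N) => [|/negP]; rewrite ?leq_addl // -leNgt addSn.
  have AN : 0 < A N `^ (- delta) by rewrite powR_gt0 // (pos N _).1.
  (* The number of terms exceeds [S] divided by the lower bound of each term, so this block sums to
     more than [S]. *)
  have := hS N (N + (Num.truncn (S / A N `^ (- delta))).+1)%N isT.
  rewrite leNgt => /negP; apply.
  set K := (Num.truncn _).+1.
  apply: (@lt_le_trans _ _ (\sum_(N <= i < N + K) A N `^ (- delta))).
    rewrite sumr_const_nat addKn -[_ *+ _]mulr_natl -ltr_pdivrMr //.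
    exact: truncnS_gt.
  apply: ler_sum_nat => i /andP[Ni _].
  have Ai : 0 < A i by apply: (pos i _).1; exact: leqW.
  have AN0 : 0 < A N by exact: (pos N _).1.
  rewrite !powRN lef_pV2 ?posrE ?powR_gt0 //.
  by apply: ge0_ler_powR; rewrite ?nnegrE ?(ltW delta0) ?(ltW Ai) ?(ltW AN0) ?Ale.
(* The quantity [c n * (A n.+1 - A n)] increases, so a single rise of A persists. *)
have inc n : (n0 <= n)%N -> A n < A n.+1.
  move=> /subnK <-; elim: (n - n0)%N => [//|j]; rewrite addSn.
  set n1 := (j + n0)%N => IH.
  have Nn1 : (N <= n1)%N by rewrite (leq_trans Nn0) // leq_addl.
  have [A1 c1] := pos n1 (leqW Nn1).
  have [A2 c2] := pos n1.+1 (leqW (leqW Nn1)).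
  have /= hb := bn n1.+1 (leqW (leqW Nn1)).
  have /= hA := Asol n1.+1 isT.
  rewrite -(ltr_pM2l c2) -subr_gt0.
  have -> : c n1.+1 * A n1.+2 - c n1.+1 * A n1.+1
      = (b n1.+1 - (c n1.+1 + c n1)) * A n1.+1 + c n1 * (A n1.+1 - A n1).
    by apply/eqP; rewrite -subr_eq0 -hA; apply/eqP; ring.
  by rewrite addr_gt0 // mulr_gt0 // subr_gt0.
exists n0 => // m /= n0m n mn.
rewrite -(subnK mn); elim: (n - m)%N => [//|j IH].
by apply: (le_trans IH); apply/ltW/inc; rewrite (leq_trans n0m) // leq_addl.
Qed.

(** * Rate of convergence of the ratios *)

Lemma ratio_approx {R : realType} (b c A B : nat -> R) (k delta : R) :
  is_solution b c A -> is_solution b c B -> c 0%N * casoratian A B 0 != 0 ->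
  (\forall n \near \oo, 0 < A n /\ 0 < c n) ->
  {near \oo, nondecreasing_seq A} ->
  1 <= k -> div_conj delta k <= 2 ->
  negpow_summable (fun n => c n.-1) k -> negpow_summable A delta ->
  exists L C : R, B m / A m @[m --> \oo] --> L /\
    \forall m \near \oo, A m * L - B m != 0 /\
      `|A m * L - B m| <= C * A m `^ (div_conj delta k - 1).
Proof.
move=> Asol Bsol; have := casoratian_const _ _ _ _ Asol Bsol.
move: (c 0%N * _) => w wE w0 [N1 _ pos] [N2 _ Ale] k1.
set th := div_conj delta k => th2.
move=> /negpow_summable_bounded[Sc hSc] /negpow_summable_bounded[SA hSA].
(* Dividing by [w] makes the increments of [r] positive whatever the sign of [w]. *)
pose N := (maxn N1 N2).+1; pose r n := B n / A n / w.
have A0 n : (N <= n)%N -> 0 < A n.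
  by move=> Nn; apply: (pos n _).1; rewrite /= (leq_trans (leqW (leq_maxl N1 N2))).
have c0 n : (N <= n)%N -> 0 < c n.
  by move=> Nn; apply: (pos n _).2; rewrite /= (leq_trans (leqW (leq_maxl N1 N2))).
have ndA m n : (N <= m <= n)%N -> A m <= A n.
  move=> /andP[Nm mn]; apply: (Ale m) => //=.
  by rewrite (leq_trans (leqW (leq_maxr N1 N2))).
have rS n : (N <= n)%N -> r n.+1 - r n = (c n * A n * A n.+1)^-1.
  move=> Nn; have An := A0 n Nn; have ASn := A0 _ (leqW Nn).
  have cn := c0 n Nn; rewrite /r.
  have -> : B n.+1 / A n.+1 / w - B n / A n / w
      = casoratian A B n / (A n * A n.+1) / w.
    by rewrite /casoratian; field; rewrite w0 !gt_eqF.
  have cas0 : casoratian A B n != 0.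
    by apply: contraNneq w0 => cas0; rewrite -(wE n) cas0 mulr0.
  by rewrite -(wE n); field; rewrite cas0 !gt_eqF.
have rlt n : (N <= n)%N -> r n < r n.+1.
  move=> Nn; rewrite -subr_gt0 rS // invr_gt0 !mulr_gt0 ?c0 ?A0 //.
  exact: leqW.
have ler m n : (N <= m <= n)%N -> r m <= r n.
  move=> /andP[Nm mn]; rewrite -(subnK mn); elim: (n - m)%N => [//|j IH].
  by apply: (le_trans IH); apply/ltW/rlt; rewrite (leq_trans Nm) // leq_addl.
(* Used twice: at [m = N] it bounds [r] and yields convergence; for general [m], letting [n] tend to
   infinity yields the rate. *)
have rup m n : (N <= m <= n)%N -> r n <= r m + (Sc + SA) * A m `^ (th - 2).
  move=> /andP[Nm mn]; rewrite -lerBlDl -telescope_sumr //.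
  have Am := A0 m Nm.
  apply: (@le_trans _ _ (\sum_(m <= i < n)
      (c i `^ (- k) + A i `^ (- delta)) * A m `^ (th - 2))).
    apply: ler_sum_nat => i /andP[mi _].
    have Ni := leq_trans Nm mi; have Ai := A0 i Ni; have ci := c0 i Ni.
    (* [A i <= A i.+1] bounds the increment by [1 / (c i * A i ^+ 2)], and the exponent [- 2] of
       [A i] is split as [- th + (th - 2)]. *)
    rewrite rS //; apply: (@le_trans _ _ ((c i)^-1 * A i `^ (- th) * A i `^ (th - 2))).
      rewrite -[leRHS]mulrA -powRD; last by rewrite (gt_eqF Ai) implybT.
      rewrite addrA addNr add0r powR_invn ?(ltW Ai) // -invfM.
      rewrite lef_pV2 ?posrE ?mulr_gt0 ?A0 ?exprn_gt0 ?leqW //.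
      by rewrite -mulrA ler_pM2l // expr2 ler_pM2l // ndA // Ni leqnSn.
    apply: ler_pM; rewrite ?mulr_ge0 ?powR_ge0 ?invr_ge0 ?(ltW ci) //.
      exact: young_div_conj.
    (* As [th - 2 <= 0], the power does not increase with its base, so [A i] may be replaced by the
       smaller [A m]. *)
    rewrite -[th - 2]opprB !powRN lef_pV2 ?posrE ?powR_gt0 //.
    by apply: ge0_ler_powR; rewrite ?nnegrE ?subr_ge0 ?(ltW Am) ?(ltW Ai) ?ndA ?Nm.
  rewrite -mulr_suml ler_wpM2r ?powR_ge0 // big_split /= lerD //.
    (* The summable series has terms in [c n.-1], hence the shift of the block by one. *)
    by have := hSc m.+1 n.+1 isT; rewrite big_add1.
  by apply: hSA; exact: leq_trans Nm.
have rcvg : cvgn r.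
  apply: (@near_nondecreasing_is_cvgn _ _ (r N + (Sc + SA) * A N `^ (th - 2))).
    by exists N => // m /= Nm n mn; apply: ler; rewrite Nm.
  by exists N => // n /= Nn; apply: rup; rewrite leqnn.
exists (limn r * w), (`|w| * (Sc + SA)); split.
  have -> : (fun m => B m / A m) = (fun m => r m * w).
    by apply/funext => m; rewrite /r divfK.
  exact: cvgMl.
exists N => // m /= Nm; have Am := A0 m Nm.
(* The limit is at least [r m.+1], which exceeds [r m]; this strictness keeps [A m * L - B m] from
   vanishing. *)
have lgt : r m < limn r.
  apply: (lt_le_trans (rlt m Nm)); apply: limr_ge => //.
  by exists m.+1 => // n /= mn; apply: ler; rewrite (leqW Nm).
have lle : limn r <= r m + (Sc + SA) * A m `^ (th - 2).
  apply: limr_le => //.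
  by exists m => // n /= mn; apply: rup; rewrite Nm.
have -> : A m * (limn r * w) - B m = A m * w * (limn r - r m).
  by rewrite /r; field; rewrite w0 gt_eqF.
split; first by rewrite !mulf_neq0 ?(gt_eqF Am) // subr_eq0 gt_eqF.
rewrite !normrM (gtr0_norm Am) [_ * `|w|]mulrC -!mulrA ler_wpM2l //.
have -> : th - 1 = 1 + (th - 2) by ring.
rewrite powRD ?(gt_eqF Am) ?implybT // powRr1 ?(ltW Am) // mulrCA ler_wpM2l ?(ltW Am) //.
by rewrite gtr0_norm ?subr_gt0 // lerBlDl.
Qed.

(** * Irrationality of the limit *)

Theorem theorem3p1 (R : realType) (b c : nat -> R) (n0 : nat) (k : R)
    (eps : nat -> R) (A B : nat -> R) (delta : R) (d e : nat -> nat)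
    (hn0 : (1 <= n0)%N)
    (c_neq0 : forall n : nat, c n != 0)
    (c_gt0 : forall n : nat, (n0 <= n)%N -> 0 < c n)
    (hk : 1 <= k)
    (c_summable : negpow_summable (fun n => c n.-1) k)
    (eps_gt0 : forall n : nat, (1 <= n)%N -> 0 < eps n)
    (eps_div : (\sum_(1 <= n <oo) (eps n)%:E = +oo)%E)
    (hb : \forall n \near \oo, b n - c n - c n.-1 > eps n * c n)
    (A_sol : is_solution b c A)
    (A_init : 0 <= A 0%N < A 1%N)
    (A_rat : \forall m \near \oo, 0 < A m /\ rational (A m))
    (delta_gt0 : 0 < delta)
    (delta_lt : (delta%:E < hoelder_conjugate k%:E)%E)
    (A_summable : negpow_summable A delta)
    (B_sol : is_solution b c B)
    (AB_indep : lin_indep A B)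
    (B_rat : \forall m \near \oo, rational (B m))
    (d_gt0 : forall m : nat, (0 < d m)%N)
    (e_gt0 : forall m : nat, (0 < e m)%N)
    (dA_int : \forall m \near \oo,
      0 < (d m)%:R * A m /\ (d m)%:R * A m \is a Num.int)
    (eB_int : \forall m \near \oo,
      0 < (e m)%:R * B m /\ (e m)%:R * B m \is a Num.int)
    (lcm_lim : (lcmn (d m) (e m))%:R / (A m `^ (1 - div_conj delta k))
      @[m --> \oo] --> (0 : R)) :
  exists L : R, B m / A m @[m --> \oo] --> L /\ irrational L.
Proof.
have c_gt0' : \forall n \near \oo, 0 < c n by exists n0.
have Ac_gt0 : \forall n \near \oo, 0 < A n /\ 0 < c n.
  by near=> n; split; [apply: (near A_rat n _).1 | near: n].
have b_gt : \forall n \near \oo, c n + c n.-1 < b n.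
  near=> n.
  have bn : b n - c n - c n.-1 > eps n * c n by near: n.
  have en : 0 < eps n by apply: eps_gt0; near: n; exists 1%N.
  have cn : 0 < c n by near: n.
  by have := mulr_gt0 en cn; lra.
have ndA := solution_nondecreasing _ _ _ _ A_sol Ac_gt0 b_gt delta_gt0 A_summable.
have A1 : A 1%N != 0.
  by rewrite gt_eqF //; case/andP: A_init => /le_lt_trans; apply.
have W0 : c 0%N * casoratian A B 0 != 0.
  by rewrite mulf_neq0 // (casoratian_neq0 b c).
have th1 := div_conj_lt1 _ _ hk delta_lt.
have [|L [C [BAL hL]]] :=
  ratio_approx _ _ _ _ _ _ A_sol B_sol W0 Ac_gt0 ndA hk _ c_summable A_summable.
  by rewrite (le_trans (ltW th1)) // ler1n.
exists L; split => //.
apply: (@irrational_approx _ _ (fun m => (lcmn (d m) (e m))%:R * A m)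
                               (fun m => (lcmn (d m) (e m))%:R * B m)).
  near=> m; split.
  - have /dvdnP[q ->] := dvdn_lcml (d m) (e m).
    rewrite natrM -mulrA rpredM ?rpred_nat //.
    by apply: (near dA_int m _).2.
  - have /dvdnP[q ->] := dvdn_lcmr (d m) (e m).
    rewrite natrM -mulrA rpredM ?rpred_nat //.
    by apply: (near eB_int m _).2.
  - rewrite -mulrA -mulrBr mulf_neq0 //.
      by rewrite pnatr_eq0 -lt0n lcmn_gt0 d_gt0 e_gt0.
    by apply: (near hL m _).1.
apply: norm_cvg0.
(* The error bound carries [A m] to the power [div_conj delta k - 1], the inverse of the power in
   [lcm_lim], so the majorant is [C] times a null sequence. *)
apply: (@squeeze_cvgr _ _ _ _ (fun=> 0)
  (fun m => C * ((lcmn (d m) (e m))%:R / A m `^ (1 - div_conj delta k)))).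
- near=> m; rewrite normr_ge0 /=.
  rewrite -mulrA -mulrBr normrM normr_nat mulrCA ler_wpM2l //.
  rewrite -powRN opprB; exact: (near hL m _).2.
- exact: cvg_cst.
- by rewrite -[X in _ --> X](mulr0 C); exact: cvgMr.
Unshelve. all: by end_near. Qed.
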